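(* Let $A=[a_{ij}]_{i,j=0}^n\in\mathrm{Sym}(\mathbb R^{n+1})$ with $A\neq\mathrm{diag}(0,A^+)$. Then $$\widehat\Theta(A)=\lim_{p\to\infty}\mathrm{tr}\tan^{-1}(A_p)=\frac\pi2\,\mathrm{sign}(a_{00})+\sum_{j=1}^n\tan^{-1}\mu_j(A).$$
   Context: $I_n=\mathrm{diag}(0,1,\dots,1)$, $I_n^p=\mathrm{diag}(p,1,\dots,1)$, $A_p=I_n^pAI_n^p$, $A^+=[a_{ij}]_{i,j=1}^n$. $\arg\in(-\pi,\pi]$, $\tan^{-1}\in(-\pi/2,\pi/2)$ (via eigenvalues for symmetric matrices); $\mathrm{sign}(x)\in\{-1,0,1\}$. $\widehat\Theta(A)=\sum_{\lambda\in\mathrm{spec}(I_n+\sqrt{-1}A)}m(\lambda)\arg\lambda$ with $m(\lambda)$ the algebraic multiplicity. $\sigma_j(M)$ is the sum of principal $j\times j$ minors ($\sigma_0=1$, $\sigma_j=0$ beyond the size); $\rho_i(A)=\sigma_i(A)-\sigma_i(A^+)$ for $i\le n$, $\rho_{n+1}(A)=\sigma_{n+1}(A)$; $\chi_A^\infty(\mu)=\sum_{i=0}^n(-\mu)^i\rho_{n+1-i}(A)$, whose roots are all real. If $a_{00}\ne0$, $\mu_1(A)\ge\dots\ge\mu_n(A)$ are its $n$ roots; if $a_{00}=0$, $\mu_1(A)\ge\dots\ge\mu_{n-1}(A)$ are its $n-1$ roots and $\mu_n(A):=0$. *)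

(* Defs.v *)
From Stdlib Require Import Reals Lra List Arith.
Import ListNotations.
Open Scope R_scope.

Record Cpx := mkC { Cre : R; Cim : R }.
Definition Cadd (z w : Cpx) : Cpx := mkC (Cre z + Cre w) (Cim z + Cim w).
Definition Cmul (z w : Cpx) : Cpx :=
  mkC (Cre z * Cre w - Cim z * Cim w) (Cre z * Cim w + Cim z * Cre w).
Definition Copp (z : Cpx) : Cpx := mkC (- Cre z) (- Cim z).
Definition C0 : Cpx := mkC 0 0.
Definition C1 : Cpx := mkC 1 0.

(* principal argument, with values in (-PI, PI]  (arg 0 := 0, never used) *)
Definition Carg (z : Cpx) : R :=
  let x := Cre z in let y := Cim z in
  if Rlt_dec 0 x then atan (y / x)
  else if Rlt_dec x 0 then
         (if Rle_dec 0 y then atan (y / x) + PI else atan (y / x) - PI)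
  else if Rlt_dec 0 y then PI / 2
  else if Rlt_dec y 0 then - (PI / 2) else 0.

Definition minor0 {T} (j : nat) (M : nat -> nat -> T) : nat -> nat -> T :=
  fun r c => M (S r) (if Nat.ltb c j then c else S c).

Fixpoint gdet {T} (add mul : T -> T -> T) (opp : T -> T) (zero one : T)
  (N : nat) (M : nat -> nat -> T) {struct N} : T :=
  match N with
  | O => one
  | S m =>
      fold_right
        (fun j acc =>
           add (mul (if Nat.even j then M O j else opp (M O j))
                    (gdet add mul opp zero one m (minor0 j M))) acc)
        zero (seq 0 (S m))
  end.

Definition Rdet (N : nat) (M : nat -> nat -> R) : R := gdet Rplus Rmult Ropp 0 1 N M.
Definition Cdet (N : nat) (M : nat -> nat -> Cpx) : Cpx := gdet Cadd Cmul Copp C0 C1 N M.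

Definition Rsum (l : list R) : R := fold_right Rplus 0 l.

Fixpoint subseqs (l : list nat) : list (list nat) :=
  match l with
  | [] => [[]]
  | x :: t => let r := subseqs t in map (cons x) r ++ r
  end.

Definition psub (Sx : list nat) (M : nat -> nat -> R) : nat -> nat -> R :=
  fun r c => M (nth r Sx O) (nth c Sx O).

Definition sigma (j N : nat) (M : nat -> nat -> R) : R :=
  Rsum (map (fun Sx => Rdet (length Sx) (psub Sx M))
            (filter (fun Sx => Nat.eqb (length Sx) j) (subseqs (seq 0 N)))).

Definition Aplus (A : nat -> nat -> R) : nat -> nat -> R := fun i j => A (S i) (S j).

Definition rho (n : nat) (A : nat -> nat -> R) (i : nat) : R :=
  if Nat.leb i n then sigma i (S n) A - sigma i n (Aplus A)
  else sigma (S n) (S n) A.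

Definition chi_inf (n : nat) (A : nat -> nat -> R) (mu : R) : R :=
  Rsum (map (fun i => (- mu) ^ i * rho n A (S n - i)) (seq 0 (S n))).

Definition Rprod_lin (l : list R) (x : R) : R := fold_right Rmult 1 (map (fun m => x - m) l).

Definition sorted_desc (l : list R) : Prop :=
  forall i, (S i < length l)%nat -> nth (S i) l 0 <= nth i l 0.

(* mu = [mu_1(A); ...; mu_n(A)] as defined in the paper:
   - a00 <> 0: the n roots (with multiplicity) of chi_A^infty, in
     nonincreasing order (chi has degree n, leading coeff (-1)^n rho_1);
   - a00 = 0: the n-1 roots of chi_A^infty (degree n-1, leading coeff
     (-1)^(n-1) rho_2) in nonincreasing order, followed by mu_n := 0. *)
Definition is_mu_list (n : nat) (A : nat -> nat -> R) (mu : list R) : Prop :=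
  (A O O <> 0 /\ length mu = n /\ sorted_desc mu /\
     forall x, chi_inf n A x = (-1) ^ n * rho n A 1 * Rprod_lin mu x)
  \/
  (A O O = 0 /\ exists l, mu = l ++ [0] /\ length l = (n - 1)%nat /\ sorted_desc l /\
     forall x, chi_inf n A x = (-1) ^ (n - 1) * rho n A 2 * Rprod_lin l x).

(* L lists the eigenvalues of the real N x N matrix M with algebraic
   multiplicity: det(x I - M) = prod (x - l) *)
Definition is_specR (N : nat) (M : nat -> nat -> R) (L : list R) : Prop :=
  length L = N /\
  forall x, Rdet N (fun i j => (if Nat.eqb i j then x else 0) - M i j) = Rprod_lin L x.

Definition is_specC (N : nat) (M : nat -> nat -> Cpx) (L : list Cpx) : Prop :=
  length L = N /\
  forall z, Cdet N (fun i j => Cadd (if Nat.eqb i j then z else C0) (Copp (M i j)))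
            = fold_right Cmul C1 (map (fun l => Cadd z (Copp l)) L).

Definition symmetric (N : nat) (A : nat -> nat -> R) : Prop :=
  forall i j, (i < N)%nat -> (j < N)%nat -> A i j = A j i.

Definition diag0Aplus (A : nat -> nat -> R) : nat -> nat -> R :=
  fun i j => if orb (Nat.eqb i 0) (Nat.eqb j 0) then 0 else A i j.

Definition Inp (p : R) (i : nat) : R := if Nat.eqb i 0 then p else 1.
Definition Ap (p : R) (A : nat -> nat -> R) : nat -> nat -> R :=
  fun i j => Inp p i * A i j * Inp p j.

Definition InPlusiA (A : nat -> nat -> R) : nat -> nat -> Cpx :=
  fun i j => mkC (if andb (Nat.eqb i j) (negb (Nat.eqb i 0)) then 1 else 0) (A i j).

Definition Rsign (x : R) : R :=
  if Rlt_dec 0 x then 1 else if Rlt_dec x 0 then -1 else 0.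

(* Main.v *)
(** The matrix [diag(t, s, ..., s) + i u A] has the determinant
    [prod_k (s + i u b_k) * (t + i u a00 + u^2 sum_k c_k / (s + i u b_k))],
    where the [b_k] are the eigenvalues of [A^+] and the [c_k >= 0] are the
    squared moduli of the coordinates of the first row in an eigenbasis. For
    [s = 1] and [0 <= t], every factor lies in the closed right half-plane and,
    once a power of [u] is removed when [t = 0], none vanishes, so the sum of
    the arguments of the factors is a continuous argument of the determinant.

    Each of the three quantities of the theorem gives another continuous
    argument of such a determinant along a path [0 <= u <= 1]:
    [prod (1 - u + u lambda)] for the spectrum of [I_n + i A] ([t = 1 - u]),
    [prod (1 + i u l)] for the spectrum of [A_p] ([t = 1 / p^2]), and
    [i u a00 prod (1 + i u mu)], or [u^2 |a|^2 prod (1 + i u mu)] when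
    [a00 = 0], for the roots of [chi_inf] ([t = 0]). Two continuous arguments
    that agree at [u = 0] agree at [u = 1], and the value at [u = 1] depends
    continuously on [t] at [t = 0]. *)

Require Import Defs.
From Stdlib Require Import Reals Ranalysis5 List Lra Lia.
From mathcomp Require all_boot all_order all_algebra complex Rstruct spectral.
Open Scope R_scope.

Definition Cinv (z : Cpx) : Cpx :=
  let m := Cre z ^ 2 + Cim z ^ 2 in mkC (Cre z / m) (- (Cim z / m)).

Definition iR (y : R) : Cpx := mkC 0 y.

Definition Cprod {I} (F : I -> Cpx) (l : list I) : Cpx := fold_right Cmul Defs.C1 (map F l).

Definition Csum {I} (F : I -> Cpx) (l : list I) : Cpx := fold_right Cadd Defs.C0 (map F l).

Definition pencil (t s : Cpx) (u : R) (A : nat -> nat -> R) : nat -> nat -> Cpx :=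
  fun i j => Cadd (if Nat.eqb i j then (if Nat.eqb i 0 then t else s) else Defs.C0)
                  (iR (u * A i j)).

(* [bc] lists the pairs [(b_k, c_k)] of the factorisation. *)
Definition resolvent (bc : list (R * R)) (s : Cpx) (u : R) : Cpx :=
  Csum (fun q => Cmul (mkC (snd q) 0) (Cinv (Cadd s (iR (u * fst q))))) bc.

Module Pencil.
Import all_boot all_order all_algebra complex Rstruct spectral.
Import Order.TTheory GRing.Theory Num.Theory.
Set Implicit Arguments.
Unset Strict Implicit.
Local Open Scope ring_scope.
Local Open Scope sesquilinear_scope.

(** * Determinants, the bordered determinant and extension of scalars *)

Lemma List_seq_iota m n : List.seq m n = iota m n.
Proof. by elim: n m => //= n IH m; rewrite IH. Qed.

Lemma Nat_eqbE i j : Nat.eqb i j = (i == j).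
Proof. by case: (Nat.eqb_spec i j) => [->|/eqP/negbTE ->]; rewrite ?eqxx. Qed.

Lemma List_nthE s i : List.nth i s 0%N = nth 0%N s i.
Proof. by elim: s i => [|a s IH] [|i] /=. Qed.

(** Both sides are Laplace expansions along the first row, so it suffices that [f] respects the raw
    operations. Taking [f] to be [toC] or the identity gives access to matrix algebra. *)
Lemma gdetE (T : Type) (K : comNzRingType) (f : T -> K) (add mul : T -> T -> T)
    (opp : T -> T) (zero one : T) :
  {morph f : x y / add x y >-> x + y} -> {morph f : x y / mul x y >-> x * y} ->
  {morph f : x / opp x >-> - x} -> f zero = 0 -> f one = 1 ->
  forall N M, f (gdet add mul opp zero one N M) =
              \det (\matrix_(i < N, j < N) f (M i j)).
Proof.
move=> fD fM fN f0 f1; elim=> [|N IH] M; first by rewrite det_mx00 /= f1.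
rewrite (expand_det_row _ ord0).
have gsum (F : nat -> T) (l : seq nat) :
    f (List.fold_right (fun j acc => add (F j) acc) zero l) = \sum_(j <- l) f (F j).
  by elim: l => [|j l IHl] /=; rewrite ?big_nil ?f0 // big_cons fD IHl.
have := gsum (fun j => mul (if Nat.even j then M O j else opp (M O j))
                (gdet add mul opp zero one N (minor0 j M))) (List.seq 0 N.+1).
move=> ->.
rewrite List_seq_iota -[iota 0 N.+1]/(index_iota 0 N.+1) big_mkord; apply: eq_bigr => j _.
rewrite fM IH /cofactor !mxE mulrA; congr (_ * _).
  rewrite add0n -signr_odd.
  have -> : Nat.even j = ~~ odd j.
    by elim: (nat_of_ord j) => // k IHk; rewrite Nat.even_succ -Nat.negb_even IHk.
  by case: (odd j); rewrite /= ?fN ?expr1 ?expr0 ?mulrN1 ?mulr1.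
congr (\det _); apply/matrixP => r c; rewrite !mxE /minor0; congr (f (M _ _)).
rewrite [RHS]/= /bump leqNgt.
have -> : Nat.ltb c j = (c < j)%N by apply/idP/idP => [/Nat.ltb_lt/ssrnat.ltP|/ssrnat.ltP/Nat.ltb_lt].
by case: (c < j)%N.
Qed.

(** The spectral theorem gives a unitary P that diagonalises M. With x = P v^T, the coefficient c_k
    is |x_k|^2, and unitarity preserves the squared norm of v. What remains is the Schur complement
    of the diagonal block. *)
Lemma bordered_det (C : numClosedFieldType) (n : nat) (a : C) (v : 'rV[C]_n) (M : 'M[C]_n) :
  v \is a mxOver Num.real -> M \is a mxOver Num.real -> M \is symmetricmx ->
  exists b c : 'I_n -> C,
  [/\ forall k, b k \is Num.real, forall k, 0 <= c k,
      \sum_k c k = \sum_k v 0 k ^+ 2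
    & forall t s w : C, (forall k, s + w * b k != 0) ->
      \det (block_mx (t + w * a)%:M (w *: v) (w *: v^T) (s%:M + w *: M)) =
      \prod_k (s + w * b k) * (t + w * a - w ^+ 2 * \sum_k c k / (s + w * b k))].
Proof.
move=> vR MR Msym.
have Mh : M \is hermsymmx by apply: realsym_hermsym.
have := orthomx_spectralP (hermitian_normalmx Mh).
have bR := hermitian_spectral_diag_real Mh.
have PU := spectral_unitarymx M; have Pu := spectral_unit M.
set P := spectralmx M in PU Pu *; set d := spectral_diag M in bR *.
move=> ME; pose x := P *m v^T.
have xE : v *m P^t* = x ^t*.
  by rewrite /x trmx_mul map_mxM trmxK (realmxC vR).
have PP : P^t* *m P = 1%:M by rewrite -invmx_unitary // mulVmx.
exists (d 0), (fun k => `|x k 0| ^+ 2); split.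
- by move=> k; exact: (mxOverP bR).
- by move=> k; rewrite exprn_ge0.
- have -> : \sum_k `|x k 0| ^+ 2 = (x^t* *m x) 0 0.
    by rewrite !mxE; apply: eq_bigr => k _; rewrite !mxE normCKC.
  rewrite -xE /x mulmxA -(mulmxA v) PP mulmx1 !mxE.
  by apply: eq_bigr => k _; rewrite !mxE expr2.
move=> t s w nz.
pose D := diag_mx (\row_k (s + w * d 0 k)).
pose Di := diag_mx (\row_k (s + w * d 0 k)^-1).
have DDi : D *m Di = 1%:M.
  apply/matrixP => i j; rewrite mul_diag_mx !mxE.
  by case: eqP => [->|_]; rewrite ?mulr0n ?mulr0 // mulr1n divff.
have sME : s%:M + w *: M = invmx P *m D *m P.
  have -> : D = s%:M + w *: diag_mx d.
    by apply/matrixP => i j; rewrite !mxE; case: eqP => [->|]; rewrite ?mulr1n ?mulr0n ?mulr0 ?addr0.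
  rewrite mulmxDr mulmxDl -scalemxAr -scalemxAl -ME mul_mx_scalar -scalemxAl.
  by rewrite mulVmx // scalemx1.
(* Conjugation by diag(1, P) turns the lower right block into the diagonal [D]. *)
have -> : \det (block_mx (t + w * a)%:M (w *: v) (w *: v^T) (s%:M + w *: M)) =
   \det (block_mx 1%:M 0 0 (invmx P) *m
         block_mx (t + w * a)%:M (w *: x^t*) (w *: x) D *m block_mx 1%:M 0 0 P : 'M_(1 + n)).
  rewrite !mulmx_block !(mul1mx, mul0mx, mulmx0, mulmx1, addr0, add0r).
  by rewrite sME -xE /x -!scalemxAr -!scalemxAl mulKmx // -(mulmxA v) PP mulmx1.
rewrite !det_mulmx !det_ublock !det1 !mul1r mulrAC -det_mulmx mulVmx // det1 mul1r.
(* A unipotent column operation clears the lower left block and leaves the Schur complement in the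
   corner. *)
have -> : \det (block_mx (t + w * a)%:M (w *: x^t*) (w *: x) D) =
   \det (block_mx (t + w * a)%:M (w *: x^t*) (w *: x) D *m
         block_mx 1%:M 0 (- w *: (Di *m x)) 1%:M : 'M_(1 + n)).
  by rewrite det_mulmx det_lblock !det1 !mulr1.
rewrite mulmx_block !(mul1mx, mul0mx, mulmx0, mulmx1, addr0, add0r).
rewrite -!scalemxAr (mulmxA D) DDi mul1mx [in X in block_mx _ _ X _]scaleNr subrr det_ublock det_mx11 mulrC.
congr (_ * _); first by rewrite det_diag; apply: eq_bigr => k _; rewrite mxE.
rewrite mxE [_%:M _ _]mxE eqxx mulr1n scaleNr -scalemxAl scalerA -expr2.
rewrite !mxE; congr (_ - _ * _); apply: eq_bigr => k _.
by rewrite mul_diag_mx !mxE normCKC -mulrA [_^-1 * _]mulrC.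
Qed.

(** In characteristic zero the difference has as many distinct integer roots as its size. *)
Lemma horner_ext (K : numDomainType) (p q : {poly K}) :
  (forall x, p.[x] = q.[x]) -> p = q.
Proof.
move=> pq; apply/eqP; rewrite -subr_eq0; apply/eqP.
apply: (@roots_geq_poly_eq0 _ _ [seq i%:R | i <- iota 0 (size (p - q))]).
- by apply/allP => x _; rewrite /root !hornerE pq subrr.
- by rewrite map_inj_uniq ?iota_uniq // => i j /eqP; rewrite eqr_nat => /eqP.
- by rewrite size_map size_iota.
Qed.

(** An identity at all points of K is one of polynomials, so it survives evaluation at z / w in the
    extension L; homogeneity of the determinant then restores w. This carries real factorisations to
    imaginary arguments. *)
Lemma det_pencil_extend (K : numFieldType) (L : fieldType) (f : {rmorphism K -> L})
    (N : nat) (D B : 'M[K]_N) (c : K) (m : seq K) :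
  (size m <= N)%N ->
  (forall x, \det (x *: D + B) = c * \prod_(y <- m) (x - y)) ->
  forall z w : L, w != 0 ->
  \det (z *: map_mx f D + w *: map_mx f B) =
  w ^+ (N - size m) * f c * \prod_(y <- m) (z - w * f y).
Proof.
move=> mN DB z w w0.
pose p := \det ('X *: map_mx polyC D + map_mx polyC B).
have pE : p = c%:P * \prod_(y <- m) ('X - y%:P).
  apply: horner_ext => x; rewrite hornerM hornerC horner_prod.
  under eq_bigr do rewrite hornerXsubC.
  rewrite -DB -[LHS]/(horner_eval x p) -det_map_mx; congr (\det _).
  by apply/matrixP => i j; rewrite !mxE /= /horner_eval !hornerE.
have cfz : commr_rmorph f (z / w) by move=> y; exact: mulrC.
have -> : z *: map_mx f D + w *: map_mx f B =
          w *: map_mx (horner_morph cfz) ('X *: map_mx polyC D + map_mx polyC B).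
  apply/matrixP => i j; rewrite !mxE rmorphD rmorphM /= horner_morphX !horner_morphC.
  by rewrite mulrDr mulrA mulrCA divff // mulr1.
rewrite detZ det_map_mx -/p pE rmorphM /= horner_morphC rmorph_prod /=.
under eq_bigr do rewrite rmorphB /= horner_morphX horner_morphC.
rewrite -[in LHS](subnK mN) exprD -!mulrA; congr (_ * _).
rewrite mulrCA; congr (_ * _).
elim: m {mN DB pE} => [|y m IH]; first by rewrite !big_nil /= expr0 mulr1.
rewrite !big_cons /= exprS -IH [LHS]mulrACA; congr (_ * _).
by rewrite mulrBr mulrCA divff // mulr1.
Qed.

(** * Complex numbers as pairs, and the factorised determinant of the pencil *)

Definition toC (z : Cpx) : R[i] := Complex (Cre z) (Cim z).

Lemma toC_inj : injective toC.
Proof. by move=> [a b] [c d] [-> ->]. Qed.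

Lemma CdetE N M : toC (Cdet N M) = \det (\matrix_(i < N, j < N) toC (M i j)).
Proof. by apply: gdetE => // - [a b] [c d]. Qed.

Lemma RdetE N M : Rdet N M = \det (\matrix_(i < N, j < N) M i j).
Proof. exact: (@gdetE R R id). Qed.

Lemma toC_prod (I : Type) (l : list I) (F : I -> Cpx) :
  toC (fold_right Cmul Defs.C1 (List.map F l)) = \prod_(i <- l) toC (F i).
Proof. by elim: l => [|i l IH] /=; rewrite ?big_nil // big_cons -IH. Qed.

Lemma Rsum_big (I : Type) (l : list I) (F : I -> R) :
  Rsum (List.map F l) = \sum_(i <- l) F i.
Proof. by elim: l => [|i l IH] /=; rewrite ?big_nil // big_cons -IH. Qed.

Lemma Rprod_lin_big (l : list R) (x : R) : Rprod_lin l x = \prod_(i <- l) (x - i).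
Proof. by elim: l => [|i l IH] /=; rewrite ?big_nil // big_cons -IH. Qed.

Lemma toCD z w : toC (Cadd z w) = toC z + toC w. Proof. by []. Qed.

Lemma toCN z : toC (Copp z) = - toC z. Proof. by []. Qed.

Lemma toCM z w : toC (Cmul z w) = toC z * toC w. Proof. by []. Qed.

Lemma toC0 : toC Defs.C0 = 0. Proof. by []. Qed.

Lemma toC1 : toC Defs.C1 = 1. Proof. by []. Qed.

Lemma toCV z : toC (Cinv z) = (toC z)^-1.
Proof. by rewrite /Cinv /toC !RdivE !RpowE. Qed.

Lemma toC_sum (I : Type) (l : list I) (F : I -> Cpx) :
  toC (Csum F l) = \sum_(i <- l) toC (F i).
Proof. by rewrite /Csum; elim: l => [|i l IH] /=; rewrite ?big_nil // big_cons -IH. Qed.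

Lemma toC_iR u x : toC (iR (u * x)) = Complex 0 u * x%:C%C.
Proof. by apply/eqP; rewrite eq_complex /= !RealsE !(mul0r, mulr0) oppr0 !add0r !eqxx. Qed.

Lemma sqr_iR (u : R) : Complex 0 u ^+ 2 = - (u ^+ 2)%:C%C :> R[i].
Proof.
by apply/eqP; rewrite eq_complex !expr2 /= !(mul0r, mulr0) sub0r addr0 oppr0 !eqxx.
Qed.

Lemma real_complex_sum (I : Type) (l : seq I) (F : I -> R) :
  (\sum_(i <- l) F i)%:C%C = \sum_(i <- l) (F i)%:C%C.
Proof. exact: raddf_sum. Qed.

(** This is [bordered_det] at w = i u, where - w^2 = u^2 gives the resolvent a nonnegative
    coefficient. *)
Lemma Cdet_pencil (n : nat) (A : nat -> nat -> R) : Defs.symmetric (S n) A ->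
  exists bc : list (R * R),
  (forall q, In q bc -> Rle 0 (snd q)) /\
  Rsum (List.map snd bc) = Rsum (List.map (fun j => pow (A 0%N j) 2) (List.seq 1 n)) /\
  forall t s u, Rlt 0 (Cre s) ->
    Cdet (S n) (pencil t s u A) =
    Cmul (Cprod (fun q => Cadd s (iR (u * fst q))) bc)
      (Cadd (Cadd t (iR (u * A 0%N 0%N))) (Cmul (mkC (pow u 2) 0) (resolvent bc s u))).
Proof.
move=> Asym.
pose v : 'rV[R[i]]_n := \row_j (A 0%N j.+1)%:C%C.
pose M : 'M[R[i]]_n := \matrix_(i, j) (A i.+1 j.+1)%:C%C.
have [||| b [c [bR c0 csum detE]]] := @bordered_det _ n (A 0%N 0%N)%:C%C v M.
- by apply/mxOverP => i j; rewrite mxE; apply/complex_realP; eexists.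
- by apply/mxOverP => i j; rewrite mxE; apply/complex_realP; eexists.
- apply/is_hermitianmxP; apply/matrixP => i j; rewrite !mxE expr0 mul1r.
  by rewrite Asym //; apply/ssrnat.ltP; rewrite ltnS.
have bE k : b k = (complex.Re (b k))%:C%C by rewrite RRe_real.
have cE k : c k = (complex.Re (c k))%:C%C by rewrite RRe_real // ger0_real.
exists [seq (complex.Re (b k), complex.Re (c k)) | k <- index_enum (ordinal n)]; split; [|split].
- move=> q /List.in_map_iff [k [<- _]] /=; apply/RleP.
  by have := c0 k; rewrite lecE => /andP[].
- apply: (@complexI R); rewrite !Rsum_big !real_complex_sum big_map.
  under eq_bigr do rewrite -cE.
  rewrite csum List_seq_iota -[iota 1 n]/(iota (1 + 0) n) iotaDl big_map.
  rewrite -[n in iota 0 n]subn0 big_mkord; apply: eq_bigr => k _.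
  by rewrite mxE -rmorphXn RpowE.
move=> t s u /RltP s0.
(* The real part is that of s, because b_k is real. *)
have nz k : toC s + (Complex 0 u) * b k != 0.
  rewrite bE eq_complex negb_and; apply/orP; left; apply/eqP => /=.
  by rewrite mul0r mulr0 subrr addr0 => e; move: s0; rewrite e ltxx.
apply: toC_inj; rewrite CdetE !(toCM, toCD) /Cprod /resolvent toC_prod toC_sum.
rewrite !big_map.
have iE k : toC (iR (u * complex.Re (b k))) = Complex 0 u * b k.
  by rewrite [in RHS]bE toC_iR.
under eq_bigr do rewrite toCD iE.
under [X in _ * (_ + _ * X)]eq_bigr do rewrite toCM toCV toCD iE -[toC (mkC _ _)]/((_)%:C%C) -cE.
have -> : toC (mkC (pow u 2) 0) = - (Complex 0 u) ^+ 2 by rewrite RpowE sqr_iR opprK.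
rewrite mulNr toC_iR -detE //; congr (\det _); apply/matrixP => i j.
rewrite !mxE /pencil toCD.
case: splitP => [i0 ->|i1 ->]; rewrite ?ord1 !mxE; case: splitP => [j0 ->|j1 ->]; rewrite ?ord1 !mxE toC_iR //=.
- by rewrite toC0 add0r.
- rewrite toC0 add0r Asym //; apply/ssrnat.ltP => //; by rewrite ltnS.
- congr (_ + _). rewrite -val_eqE /= !add0n.
  by case: (Nat.eqb_spec i1 j1) => [->|/eqP/negbTE ->]; rewrite ?eqxx.
Qed.

Lemma toC_real x : toC (mkC x 0) = x%:C%C. Proof. by []. Qed.

Lemma toCK (x : R[i]) : toC (mkC (complex.Re x) (complex.Im x)) = x.
Proof. by case: x. Qed.

Lemma toC_if (b : bool) z w : toC (if b then z else w) = if b then toC z else toC w.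
Proof. by case: b. Qed.

Lemma real_mul_toC u r a :
  u%:C%C * toC (mkC r a) = (u * r)%:C%C + toC (iR (u * a)).
Proof.
by apply/eqP; rewrite eq_complex /= !RealsE !mul0r subr0 !addr0 add0r !eqxx.
Qed.

(** * Principal minors *)

(** Entries are indexed by [nat] rather than by ordinals, so the size can vary with a list without
    casts. *)
Definition mdet (K : comNzRingType) (N : nat) (f : nat -> nat -> K) : K :=
  \det (\matrix_(i < N, j < N) f i j).

Lemma eq_mdet (K : comNzRingType) (N : nat) (f g : nat -> nat -> K) :
  (forall i j, (i < N)%N -> (j < N)%N -> f i j = g i j) -> mdet N f = mdet N g.
Proof. by move=> fg; congr (\det _); apply/matrixP => i j; rewrite !mxE fg. Qed.

(** In the expansion along row k only the diagonal entry sees x, and its cofactor is a principal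
    minor with sign (-1)^(2k) = 1. *)
Lemma mdet_diag_add (K : comNzRingType) (N k : nat) (f : nat -> nat -> K) (x : K) :
  (k <= N)%N ->
  mdet N.+1 (fun i j => f i j + x *+ ((i == k) && (j == k))) =
  mdet N.+1 f + x * mdet N (fun i j => f (bump k i) (bump k j)).
Proof.
rewrite -ltnS => kN; pose o := Ordinal kN.
rewrite /mdet !(expand_det_row _ o).
pose F := \matrix_(i < N.+1, j < N.+1) f i j.
transitivity (\sum_(j < N.+1) (f k j + x *+ (j == o)) * cofactor F o j).
  apply: eq_bigr => j _; rewrite !mxE eqxx /=; congr (_ * (_ * \det _)).
  apply/matrixP => a b; rewrite !mxE /= [bump k a == k]eq_sym (negbTE (neq_bump _ _)).
  by rewrite mulr0n addr0.
under eq_bigr do rewrite mulrDl.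
rewrite big_split /=; congr (_ + _); first by apply: eq_bigr => j _; rewrite !mxE.
rewrite (bigD1 o) //= eqxx mulr1n big1 ?addr0; last first.
  by move=> j /negbTE ->; rewrite mulr0n mul0r.
rewrite /cofactor addnn -signr_odd odd_double mul1r; congr (_ * \det _).
by apply/matrixP => a b; rewrite !mxE.
Qed.

Lemma size_subseqs l T : T \in subseqs l -> (size T <= size l)%N.
Proof.
elim: l T => [|a l IH] T; first by rewrite inE => /eqP ->.
rewrite [subseqs _]/= mem_cat => /orP[/mapP[U /IH UT ->]|/IH] //.
exact: leqW.
Qed.

(* The diagonal perturbation touches only the indices of [l]; adding the
   indices of [l] to [P] one at a time is linearity of the determinant in one row. *)
Lemma mdet_principal_expand (M : nat -> nat -> R) (x : R) (P l : seq nat) :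
  mdet (size (P ++ l))
    (fun i j => psub (P ++ l) M i j + x *+ ((i == j) && (size P <= i)%N)) =
  \sum_(T <- subseqs l) x ^+ (size l - size T) * mdet (size (P ++ T)) (psub (P ++ T) M).
Proof.
elim: l P => [|a t IH] P.
  rewrite /= big_seq1 !cats0 expr0 mul1r; apply: eq_mdet => i j iP _.
  by rewrite leqNgt iP andbF addr0.
(* Sublists that contain a are handled by the induction hypothesis for [rcons P a]; those that omit
   a carry one more factor x and use the hypothesis for P. *)
rewrite [subseqs _]/= big_cat big_map /=.
under eq_bigr do rewrite -cat_rcons subSS.
rewrite -IH.
have -> : \sum_(T <- subseqs t) x ^+ ((size t).+1 - size T) * mdet (size (P ++ T)) (psub (P ++ T) M)
   = x * mdet (size (P ++ t))
    (fun i j => psub (P ++ t) M i j + x *+ ((i == j) && (size P <= i)%N)).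
  rewrite IH big_distrr /= !big_seq; apply: eq_bigr => T /size_subseqs Tt.
  by rewrite subSn // exprS mulrA.
have sz : size (P ++ a :: t) = (size (P ++ t)).+1 by rewrite !size_cat addnS.
rewrite cat_rcons sz.
have kN : (size P <= size (P ++ t))%N by rewrite size_cat leq_addr.
have E := @mdet_diag_add _ _ _
  (fun i j => psub (P ++ a :: t) M i j + x *+ ((i == j) && (size (rcons P a) <= i)%N)) x kN.
transitivity (mdet (size (P ++ t)).+1
  (fun i j => psub (P ++ a :: t) M i j + x *+ ((i == j) && (size (rcons P a) <= i)%N)
     + x *+ ((i == size P) && (j == size P)))).
  apply: eq_mdet => i j _ _; rewrite size_rcons -addrA; congr (_ + _).
  rewrite -mulrnDr; congr (_ *+ _); rewrite leq_eqVlt.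
  have [->|ij] := eqVneq i j; first by rewrite andbb [size P == j]eq_sym; case: eqVneq => [->|]; rewrite ?ltnn ?orbF //= addn0.
  by case: (eqVneq i (size P)) => //= iP; rewrite -iP eq_sym (negbTE ij).
rewrite E; congr (_ + x * _); apply: eq_mdet => i j _ _.
(* Deleting row and column [size P] removes a from [P ++ a :: t]. *)
have nthb k : List.nth (bump (size P) k) (P ++ a :: t) 0%N = List.nth k (P ++ t) 0%N.
  rewrite !List_nthE !nth_cat /bump; case: (leqP (size P) k) => kP; last by rewrite add0n kP.
  by rewrite add1n ltnNge leqW //= subSn.
rewrite /psub !nthb; congr (_ + _ *+ _).
rewrite (inj_eq (can_inj (bumpK _))) size_rcons /bump.
by case: (leqP (size P) i) => h; rewrite ?add1n ?ltnS ?h //= add0n ltnNge ltnW ?andbF //.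
Qed.

Lemma sigmaE j N M :
  Defs.sigma j N M = \sum_(T <- subseqs (iota 0 N) | size T == j) mdet (size T) (psub T M).
Proof.
rewrite /Defs.sigma List_seq_iota; elim: (subseqs _) => [|T l IH]; first by rewrite big_nil.
rewrite big_cons [List.filter _ _]/= -Nat_eqbE.
by case: Nat.eqb => //=; rewrite /mdet -IH -RdetE.
Qed.

Lemma subseqs_map (f : nat -> nat) l :
  subseqs [seq f i | i <- l] = [seq [seq f i | i <- T] | T <- subseqs l].
Proof.
elim: l => //= a l ->; rewrite [List.app _ _]/(_ ++ _) map_cat; congr (_ ++ _).
by elim: (subseqs l) => //= T s ->.
Qed.

(** The principal minors of A that avoid the index 0 are those of A^+, so the subtraction leaves
    exactly the minors through 0. *)
Lemma rhoE n A j : (0 < j <= n.+1)%N ->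
  rho n A j =
  \sum_(T <- subseqs (iota 1 n) | size T == j.-1) mdet (size T).+1 (psub (0%N :: T) A).
Proof.
case: j => // j /andP[_ jn]; rewrite /rho.
have sE : Defs.sigma j.+1 n.+1 A =
   \sum_(T <- subseqs (iota 1 n) | size T == j) mdet (size T).+1 (psub (0%N :: T) A)
   + \sum_(T <- subseqs (iota 1 n) | size T == j.+1) mdet (size T) (psub T A).
  by rewrite sigmaE [subseqs _]/= big_cat big_map.
case: Nat.leb_spec => /ssrnat.leP.
  move=> _; rewrite RminusE sE sigmaE.
  rewrite -[iota 1 n]/(iota (1 + 0) n) iotaDl subseqs_map [X in _ + X - _]big_map.
  under [X in _ + X - _]eq_bigl do rewrite size_map.
  rewrite [X in _ + X - _](eq_bigr (fun T => mdet (size T) (psub T (Aplus A)))).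
    by rewrite addrK.
  move=> T _; rewrite size_map; apply: eq_mdet => a b aT bT.
  by rewrite /psub !List_nthE !(nth_map 0%N).
(* In the remaining case j = n, no sublist of 1, ..., n has n + 1 entries, so nothing has to be
   subtracted. *)
rewrite ltnS => nj.
have jE : j = n by apply/eqP; rewrite eqn_leq nj -ltnS jn.
rewrite jE in sE *; rewrite sE [X in _ + X](_ : _ = 0) ?addr0 //; rewrite big_seq_cond big1 // => T /andP[/size_subseqs]; rewrite size_iota => Tn /eqP Te.
by move: Tn; rewrite Te ltnn.
Qed.

(** The perturbation - x I_n spares the index 0, so the expansion of det(A - x I_n) runs over the
    principal minors through 0; grouped by size they are the rho of [rhoE]. *)
Lemma chi_infE n A x :
  chi_inf n A x = mdet n.+1 (fun i j => A i j - x *+ ((i == j) && (0 < i)%N)).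
Proof.
have := mdet_principal_expand A (- x) [:: 0%N] (iota 1 n).
rewrite -[[:: 0%N] ++ iota 1 n]/(iota 0 n.+1) size_iota => E.
rewrite (@eq_mdet _ _ _ (fun i j => psub (iota 0 n.+1) A i j +
           (- x) *+ ((i == j) && (0 < i)%N))); last first.
  by move=> i j i_n j_n; rewrite /psub !List_nthE !nth_iota // mulNrn.
rewrite E /chi_inf Rsum_big List_seq_iota -[iota 0 n.+1]/(index_iota 0 n.+1) big_mkord.
transitivity (\sum_(i < n.+1) \sum_(T <- subseqs (iota 1 n) | size T == (n - i)%N)
    (- x) ^+ i * mdet (size T).+1 (psub (0%N :: T) A)).
  apply: eq_bigr => i _; rewrite RpowE rhoE.
    by rewrite -[(n.+1 - i)%coq_nat]/(n.+1 - i)%N subSn ?leq_ord //= -big_distrr.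
  by rewrite -[(n.+1 - i)%coq_nat]/(n.+1 - i)%N subn_gt0 ltn_ord leq_subr.
rewrite (exchange_big_dep xpredT) //= !big_seq; apply: eq_bigr => T /size_subseqs.
(* A sublist T contributes to the single power n - size T. *)
rewrite size_iota => Tn; rewrite (big_pred1 (inord (n - size T))).
  by rewrite inordK ?ltnS ?leq_subr.
move=> i /=; rewrite -val_eqE /= inordK ?ltnS ?leq_subr //.
have := leq_ord i => i_n.
by apply/eqP/eqP => ->; rewrite subKn.
Qed.

Lemma big_subseqs0 l (F : list nat -> R) :
  \sum_(T <- subseqs l | size T == 0%N) F T = F [::].
Proof.
elim: l => [|a l IH] /=; first by rewrite big_mkcond big_seq1.
by rewrite big_cat big_map /= IH big_pred0 // add0r.
Qed.

Lemma big_subseqs1 l (F : list nat -> R) :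
  \sum_(T <- subseqs l | size T == 1%N) F T = \sum_(a <- l) F [:: a].
Proof.
elim: l => [|a l IH] /=; first by rewrite big_mkcond big_seq1 big_nil.
rewrite big_cat big_map /= IH big_cons; congr (_ + _).
exact: (big_subseqs0 l (fun T => F (a :: T))).
Qed.

Lemma rho1E n A : rho n A 1 = A 0%N 0%N.
Proof. by rewrite rhoE // big_subseqs0 /mdet det_mx11 mxE. Qed.

(** When a00 = 0, each 2 x 2 principal minor through the index 0 is - a_{0j}^2. *)
Lemma rho2E n A : Defs.symmetric n.+1 A -> (0 < n)%N -> A 0%N 0%N = 0 ->
  rho n A 2 = Ropp (Rsum (List.map (fun j => pow (A 0%N j) 2) (List.seq 1 n))).
Proof.
move=> Asym n0 A0; rewrite RoppE rhoE ?ltnS // big_subseqs1 Rsum_big List_seq_iota -sumrN.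
rewrite !big_seq; apply: eq_bigr => j; rewrite mem_iota => /andP[_ jn].
rewrite RpowE /mdet -RdetE /Rdet /= /minor0 /psub /= A0 !RealsE.
rewrite (Asym j 0%N); [|exact/ssrnat.ltP|exact/ssrnat.ltP].
by rewrite !(mul0r, addr0, add0r, mulr1) mulNr expr2.
Qed.

(** * Pencils attached to the spectra and to [chi_inf] *)

(** The pencil is z I + u (I_n + i A), a homogenised characteristic polynomial. Arbitrary complex z
    serves two purposes: z = 1 - u follows the path, and z = - lambda locates the eigenvalues. *)
Lemma specC_pencil n A L : is_specC (S n) (InPlusiA A) L ->
  forall (z : Cpx) (u : R), u <> 0 ->
  Cdet (S n) (pencil z (Cadd z (mkC u 0)) u A) =
  Cprod (fun l => Cadd z (Cmul (mkC u 0) l)) L.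
Proof.
move=> [szL HL] z u /eqP u0; apply: toC_inj; rewrite CdetE /Cprod toC_prod.
pose B : 'M[R[i]]_n.+1 := - \matrix_(i, j) toC (InPlusiA A i j).
have szm : (size [seq toC l | l <- L] <= n.+1)%N by rewrite size_map; apply/eq_leq.
have HB x : \det (x *: 1%:M + B) = 1 * \prod_(y <- [seq toC l | l <- L]) (x - y).
  rewrite mul1r big_map -[in RHS](toCK x) -(toC_prod L (fun l => Cadd (mkC _ _) (Copp l))).
  rewrite -HL CdetE; congr (\det _); apply/matrixP => i j.
  rewrite !mxE toCD toCN toC_if toCK toC0 Nat_eqbE mulr_natr -val_eqE.
  by case: (_ == _).
have w0 : - u%:C%C != 0 :> R[i] by rewrite oppr_eq0 (inj_eq (@complexI R)).
have := @det_pencil_extend _ _ idfun _ _ _ _ _ szm HB (toC z) _ w0.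
have -> : (n.+1 - size [seq toC l | l <- L] = 0)%N by rewrite size_map -[size L]/(length L) szL subnn.
rewrite expr0 rmorph1 !mul1r big_map.
under [X in _ = X -> _]eq_bigr do rewrite mulNr opprK -toC_real -toCM -toCD.
move=> <-; congr (\det _); apply/matrixP => i j.
rewrite !mxE /= /pencil /InPlusiA !Nat_eqbE toCD mulNr mulrN opprK mulr_natr -val_eqE.
rewrite real_mul_toC; case: (_ == _); case: (nat_of_ord i == 0%N) => /=.
- by rewrite mulr0 mulr1n add0r.
- by rewrite mulr1 mulr1n addrA.
- by rewrite toC0 R0E mulr0 mulr0n rmorph0 !add0r.
- by rewrite toC0 R0E mulr0 mulr0n rmorph0 !add0r.
Qed.

(** Factoring I_n^p out of both sides of I + i u A_p leaves the pencil with corner 1 / p^2. *)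
Lemma specR_pencil n A p L : p <> 0 -> is_specR (S n) (Ap p A) L ->
  forall u : R, u <> 0 ->
  Cprod (fun l => Cadd Defs.C1 (iR (u * l))) L =
  Cmul (mkC (pow p 2) 0) (Cdet (S n) (pencil (mkC (Rinv (pow p 2)) 0) Defs.C1 u A)).
Proof.
move=> /eqP p0 [szL HL] u /eqP u0; rewrite RpowE RinvE; apply: toC_inj; rewrite toCM CdetE /Cprod toC_prod.
pose B : 'M[R]_n.+1 := - \matrix_(i, j) Ap p A i j.
have szm : (size L <= n.+1)%N by apply/eq_leq.
have HB x : \det (x *: 1%:M + B) = 1 * \prod_(y <- L) (x - y).
  rewrite mul1r -Rprod_lin_big -HL RdetE; congr (\det _); apply/matrixP => i j.
  by rewrite !mxE Nat_eqbE mulr_natr -val_eqE !RealsE; case: (_ == _).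
have w0 : - Complex 0 u != 0 :> R[i] by rewrite oppr_eq0 eq_complex negb_and u0 orbT.
have := @det_pencil_extend _ _ (real_complex R) _ _ _ _ _ szm HB 1 _ w0.
have -> : (n.+1 - size L = 0)%N by rewrite -[size L]/(length L) szL subnn.
rewrite expr0 rmorph1 !mul1r.
under [X in _ = X -> _]eq_bigr do rewrite mulNr opprK -toC_iR -toC1 -toCD.
move=> <-.
pose d : 'rV[R[i]]_n.+1 := \row_j (Inp p j)%:C%C.
(* Each of the two outer factors diag(p, 1, ..., 1) has determinant p. *)
have <- : \det (diag_mx d) ^+ 2 = toC (mkC (p ^+ 2) 0).
  rewrite det_diag big_ord_recl big1; last by move=> i _; rewrite mxE.
  by rewrite mulr1 mxE -rmorphXn.
rewrite expr2 mulrAC -!det_mulmx; congr (\det _); apply/matrixP => i j.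
rewrite mul_mx_diag mul_diag_mx !mxE /pencil !Nat_eqbE toCD toC_if toC_if toC0 toC_real toC1.
rewrite toC_iR mulr_natr -val_eqE /Ap !RealsE rmorphN mulrN mulNr opprK mulrDr mulrDl.
congr (_ + _); last by rewrite !rmorphM !mulrA (mulrC (Complex 0 u)).
have [->|_] := eqVneq (val i) (val j); last by rewrite mulr0 mul0r.
rewrite /Inp Nat_eqbE; case: (_ == _); last by rewrite !mul1r.
rewrite -!rmorphM mulrAC -expr2 divff ?expf_neq0 //.
Qed.

(** By [chi_infE], [chi_inf] is the determinant of x D + A with D = - I_n; homogenising and taking x
    = -1 with A scaled by i u gives I_n + i u A. The drop in degree appears as a power of i u. *)
Lemma chi_pencil n A c l : (size l <= n.+1)%N ->
  (forall x, chi_inf n A x = (-1) ^+ size l * c * Rprod_lin l x) ->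
  forall u : R, u <> 0 ->
  toC (Cdet (S n) (pencil Defs.C0 Defs.C1 u A)) =
  (Complex 0 u) ^+ (n.+1 - size l) * c%:C%C *
  toC (Cprod (fun m => Cadd Defs.C1 (iR (u * m))) l).
Proof.
move=> szl Hl u /eqP u0; rewrite CdetE /Cprod toC_prod.
pose D : 'M[R]_n.+1 := \matrix_(i, j) - (1 *+ ((i == j) && (0 < i)%N)).
pose B : 'M[R]_n.+1 := \matrix_(i, j) A i j.
have HB x : \det (x *: D + B) = (-1) ^+ size l * c * \prod_(y <- l) (x - y).
  rewrite -Rprod_lin_big -Hl chi_infE; congr (\det _); apply/matrixP => i j.
  by rewrite !mxE mulrN addrC mulr_natr.
have w0 : Complex 0 u != 0 :> R[i] by rewrite eq_complex negb_and u0 orbT.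
have := @det_pencil_extend _ _ (real_complex R) _ _ _ _ _ szl HB (-1) _ w0.
have -> : \prod_(y <- l) (-1 - Complex 0 u * y%:C%C) =
          (-1) ^+ size l * \prod_(m <- l) toC (Cadd Defs.C1 (iR (u * m))).
  elim: (l) => [|m k IH]; first by rewrite !big_nil mulr1.
  by rewrite !big_cons IH /= exprS mulrACA toCD toC_iR mulN1r opprD.
have sgn : (-1) ^+ size l * (-1) ^+ size l = 1 :> R[i].
  by rewrite -exprD addnn -signr_odd odd_double.
rewrite rmorphM rmorphXn rmorphN1 -!mulrA (mulrCA c%:C%C) [(-1) ^+ _ * (_ * _)]mulrA sgn mul1r.
move=> <-; congr (\det _); apply/matrixP => i j.
rewrite !mxE /pencil !Nat_eqbE toCD toC_iR; congr (_ + _).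
rewrite rmorphN mulrNN mul1r rmorphMn rmorph1 -val_eqE lt0n.
by case: (_ == _); case: (nat_of_ord i == 0%N).
Qed.

Lemma chi_pencil1 n A c l : length l = n ->
  (forall x, chi_inf n A x = Rmult (Rmult (pow (IZR (-1)) n) c) (Rprod_lin l x)) ->
  forall u : R, u <> 0 ->
  Cdet (S n) (pencil Defs.C0 Defs.C1 u A) =
  Cmul (iR (Rmult u c)) (Cprod (fun m => Cadd Defs.C1 (iR (u * m))) l).
Proof.
move=> <- Hl u u0.
have {}Hl x := etrans (Hl x) (congr1 (fun y => y * c * _) (RpowE _ _)).
apply: toC_inj; rewrite toCM toC_iR.
by rewrite (chi_pencil (leqnSn _) Hl u0) subSnn expr1.
Qed.

(** Two powers of i u are left over, and (i u)^2 = - u^2 accounts for the sign of c; for c = rho_2 <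
    0 the prefactor is positive. *)
Lemma chi_pencil2 n A c l : length l = n ->
  (forall x, chi_inf n.+1 A x = Rmult (Rmult (pow (IZR (-1)) n) c) (Rprod_lin l x)) ->
  forall u : R, u <> 0 ->
  Cdet n.+2 (pencil Defs.C0 Defs.C1 u A) =
  Cmul (mkC (Rmult (pow u 2) (Ropp c)) 0) (Cprod (fun m => Cadd Defs.C1 (iR (u * m))) l).
Proof.
move=> <- Hl u u0.
have {}Hl x := etrans (Hl x) (congr1 (fun y => y * c * _) (RpowE _ _)).
apply: toC_inj; rewrite toCM toC_real.
rewrite (chi_pencil (leqW (leqnSn _)) Hl u0) -addn2 addKn; congr (_ * _).
by rewrite sqr_iR mulNr -rmorphM RpowE RmultE RoppE mulrN rmorphN.
Qed.

End Pencil.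

Import Pencil.

(** * Arguments of complex numbers *)

(** A relation, determined only modulo 2 pi: sums of arguments leave the principal interval. It
    forces z to be nonzero. *)
Definition is_arg (z : Cpx) (theta : R) : Prop :=
  exists r, 0 < r /\ z = mkC (r * cos theta) (r * sin theta).

Lemma is_arg_mul z w a b : is_arg z a -> is_arg w b -> is_arg (Cmul z w) (a + b).
Proof.
  intros (r & Hr & ->) (s & Hs & ->). exists (r * s).
  split; [now apply Rmult_lt_0_compat|].
  unfold Cmul; simpl; rewrite cos_plus, sin_plus. f_equal; ring.
Qed.

Lemma is_arg_real r : 0 < r -> is_arg (mkC r 0) 0.
Proof.
  intros Hr. exists r. rewrite cos_0, sin_0. split; [assumption|f_equal; ring].
Qed.

Lemma is_arg_scale r z a : 0 < r -> is_arg z a -> is_arg (Cmul (mkC r 0) z) a.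
Proof.
  intros Hr Hz. rewrite <- (Rplus_0_l a). now apply is_arg_mul; [apply is_arg_real|].
Qed.

Lemma is_arg_imag y : y <> 0 -> is_arg (iR y) (PI / 2 * Rsign y).
Proof.
  intros Hy. unfold Rsign, iR. destruct (Rlt_dec 0 y) as [Hp|Hp].
  - exists y. rewrite Rmult_1_r, cos_PI2, sin_PI2. split; [lra|f_equal; ring].
  - destruct (Rlt_dec y 0) as [Hn|]; [|lra]. exists (- y).
    replace (PI / 2 * -1) with (- (PI / 2)) by ring.
    rewrite cos_neg, sin_neg, cos_PI2, sin_PI2. split; [lra|f_equal; ring].
Qed.

Lemma is_arg_1i y : is_arg (Cadd Defs.C1 (iR y)) (atan y).
Proof.
  assert (H : 0 < 1 + Rsqr y) by (pose proof (Rle_0_sqr y); lra).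
  pose proof (sqrt_lt_R0 _ H).
  exists (sqrt (1 + Rsqr y)). split; [assumption|].
  rewrite cos_atan, sin_atan. unfold Cadd; simpl. f_equal; field; lra.
Qed.

Lemma is_arg_prod {I : Type} (F : I -> Cpx) (f : I -> R) (l : list I) :
  (forall i, In i l -> is_arg (F i) (f i)) -> is_arg (Cprod F l) (Rsum (map f l)).
Proof.
  induction l as [|i l IH]; intros H; simpl.
  - apply is_arg_real; lra.
  - apply is_arg_mul; [apply H; now left|]. apply IH. intros j Hj; apply H; now right.
Qed.

(** The condition cos (a - b) = 1 expresses congruence modulo 2 pi without an integer witness.
    Comparing squared moduli first gives r = s. *)
Lemma is_arg_unique z a b : is_arg z a -> is_arg z b -> cos (a - b) = 1.
Proof.
  intros (r & Hr & ->) (s & Hs & E). injection E as Ec Es.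
  pose proof (sin2_cos2 a) as Ha; pose proof (sin2_cos2 b) as Hb. unfold Rsqr in Ha, Hb.
  assert (Hrs : r * r = s * s).
  { replace (r * r) with (r * r * (sin a * sin a + cos a * cos a)) by (rewrite Ha; ring).
    replace (s * s) with (s * s * (sin b * sin b + cos b * cos b)) by (rewrite Hb; ring).
    transitivity ((r * sin a) * (r * sin a) + (r * cos a) * (r * cos a)); [ring|].
    rewrite Ec, Es. ring. }
  assert (r = s) by nra. subst s.
  apply Rmult_eq_reg_l in Ec; [|lra]. apply Rmult_eq_reg_l in Es; [|lra].
  rewrite cos_minus, Ec, Es. lra.
Qed.

Lemma cos_eq_1_small d : cos d = 1 -> - (2 * PI) < d < 2 * PI -> d = 0.
Proof.
  intros Hc Hd.
  replace d with (2 * (d / 2)) in Hc by field. rewrite cos_2a_sin in Hc.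
  assert (Hs : sin (d / 2) = 0) by nra.
  destruct (Rtotal_order d 0) as [H|[H|H]]; [|assumption|].
  - pose proof (sin_lt_0_var (d / 2)). lra.
  - pose proof (sin_gt_0 (d / 2)). lra.
Qed.

(** If d 1 exceeded pi, then d would take the value pi at some point, where the cosine is -1. *)
Lemma arg_lift_zero (d : R -> R) :
  (forall u, 0 <= u <= 1 -> continuity_pt d u) ->
  (forall u, 0 < u <= 1 -> cos (d u) = 1) -> d 0 = 0 -> 0 <= d 1 -> d 1 = 0.
Proof.
  intros Hc H1 H0 Hpos. pose proof PI_RGT_0.
  destruct (Rle_lt_dec (d 1) PI) as [Hle|Hgt].
  - apply cos_eq_1_small; [apply H1|]; lra.
  - exfalso.
    destruct (f_interv_is_interv d 0 1 PI) as (z & Hz & Ez); [lra|lra|assumption|].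
    destruct (Req_dec z 0) as [->|Hz0]; [lra|].
    pose proof (H1 z ltac:(lra)) as E. rewrite Ez, cos_PI in E. lra.
Qed.

(** The common complex number z is asked for only when u > 0, because the determinants attached to
    [chi_inf] can vanish at u = 0; there only the two lifts are compared. *)
Lemma arg_lift_unique (f g : R -> R) :
  (forall u, 0 <= u <= 1 -> continuity_pt f u) ->
  (forall u, 0 <= u <= 1 -> continuity_pt g u) ->
  f 0 = g 0 ->
  (forall u, 0 < u <= 1 -> exists z, is_arg z (f u) /\ is_arg z (g u)) ->
  f 1 = g 1.
Proof.
  intros Hf Hg H0 Ha. destruct (Rle_lt_dec (g 1) (f 1)) as [H|H].
  - enough (f 1 - g 1 = 0) by lra.
    apply (arg_lift_zero (fun u => f u - g u)); [| |lra|lra].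
    + intros u Hu. now apply (continuity_pt_minus f g); [apply Hf|apply Hg].
    + intros u Hu. destruct (Ha u Hu) as (z & ? & ?). now apply (is_arg_unique z).
  - enough (g 1 - f 1 = 0) by lra.
    apply (arg_lift_zero (fun u => g u - f u)); [| |lra|lra].
    + intros u Hu. now apply (continuity_pt_minus g f); [apply Hg|apply Hf].
    + intros u Hu. destruct (Ha u Hu) as (z & ? & ?). now apply (is_arg_unique z).
Qed.

(* Half-angle form of the argument: continuous on the closed right half-plane
   minus the origin, including the imaginary axis. *)
Definition half_arg (x y : R) : R := 2 * atan (y / (sqrt (x ^ 2 + y ^ 2) + x)).

Lemma modulus_pos x y : x <> 0 \/ y <> 0 -> 0 < x ^ 2 + y ^ 2.
Proof. intros [H|H]; nra. Qed.

(** With r the modulus, h = y / (r + x) is the tangent of half the argument, and r + x > 0. From y^2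
    = r^2 - x^2 come 1 + h^2 = 2 r / (r + x) and 1 - h^2 = 2 x / (r + x), and the double-angle
    formulas conclude. *)
Lemma is_arg_half x y : 0 <= x -> x <> 0 \/ y <> 0 -> is_arg (mkC x y) (half_arg x y).
Proof.
  intros Hx Hxy. pose proof (modulus_pos x y Hxy) as Hm.
  pose proof (sqrt_lt_R0 _ Hm) as Hr.
  pose proof (sqrt_sqrt (x ^ 2 + y ^ 2) ltac:(lra)) as Hrr.
  unfold half_arg. set (r := sqrt (x ^ 2 + y ^ 2)) in *.
  exists r. split; [assumption|].
  set (h := y / (r + x)).
  assert (Hh : 0 < 1 + h²) by (pose proof (Rle_0_sqr h); lra).
  pose proof (sqrt_lt_R0 _ Hh) as Hq.
  pose proof (sqrt_sqrt (1 + h²) ltac:(lra)) as Hqq.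
  rewrite cos_2a, sin_2a, cos_atan, sin_atan.
  set (q := sqrt (1 + h²)) in *.
  assert (E1 : 1 / q * (1 / q) - h / q * (h / q) = (1 - h²) / (1 + h²)).
  { rewrite <- Hqq. unfold Rsqr. field. lra. }
  assert (E2 : 2 * (h / q) * (1 / q) = 2 * h / (1 + h²)).
  { rewrite <- Hqq. field. lra. }
  rewrite E1, E2. 
  assert (E3 : 1 + h² = 2 * r / (r + x)).
  { unfold h, Rsqr. apply Rmult_eq_reg_r with ((r + x) * (r + x)); [|nra].
    field_simplify; [|lra|lra]. nra. }
  assert (E4 : 1 - h² = 2 * x / (r + x)).
  { unfold h, Rsqr. apply Rmult_eq_reg_r with ((r + x) * (r + x)); [|nra].
    field_simplify; [|lra|lra]. nra. }
  rewrite E3, E4. unfold h. f_equal; field; lra.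
Qed.

Lemma half_arg_bound x y : - PI < half_arg x y < PI.
Proof. unfold half_arg. pose proof (atan_bound (y / (sqrt (x ^ 2 + y ^ 2) + x))). lra. Qed.

Lemma half_arg_unique x y a :
  0 <= x -> x <> 0 \/ y <> 0 -> is_arg (mkC x y) a -> - (PI / 2) <= a <= PI / 2 ->
  half_arg x y = a.
Proof.
  intros Hx Hxy Ha Hb. pose proof (half_arg_bound x y).
  enough (half_arg x y - a = 0) by lra.
  apply cos_eq_1_small; [|lra].
  apply (is_arg_unique (mkC x y)); [now apply is_arg_half|assumption].
Qed.

(** The cut of [Carg] is on the negative real axis, so away from it the case distinction can be
    traded for one continuous formula. *)
Lemma Carg_half z : 0 <= Cre z -> Cre z <> 0 \/ Cim z <> 0 ->
  Carg z = half_arg (Cre z) (Cim z).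
Proof.
  destruct z as [x y]; simpl; intros Hx Hxy. pose proof PI_RGT_0. symmetry.
  destruct (Rlt_dec 0 x) as [H0|H0].
  - assert (E : Carg (mkC x y) = atan (y / x)).
    { unfold Carg; simpl. destruct (Rlt_dec 0 x); [reflexivity|lra]. }
    rewrite E. apply half_arg_unique; try assumption.
    + replace (mkC x y) with (Cmul (mkC x 0) (Cadd Defs.C1 (iR (y / x)))).
      * apply is_arg_scale; [assumption|apply is_arg_1i].
      * unfold Cmul, Cadd; simpl. f_equal; field; lra.
    + pose proof (atan_bound (y / x)). lra.
  - replace x with 0 in * by lra.
    assert (Hy : y <> 0) by (destruct Hxy; [lra|assumption]).
    assert (E : Carg (mkC 0 y) = PI / 2 * Rsign y).
    { unfold Carg, Rsign; simpl. destruct (Rlt_dec 0 0); [lra|].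
      destruct (Rlt_dec 0 y); [ring|]. destruct (Rlt_dec y 0); [field|lra]. }
    rewrite E. apply half_arg_unique; try assumption.
    + now apply is_arg_imag.
    + unfold Rsign. destruct (Rlt_dec 0 y); [lra|]. destruct (Rlt_dec y 0); lra.
Qed.

Lemma continuity_pt_half_arg (x y : R -> R) u :
  continuity_pt x u -> continuity_pt y u -> 0 <= x u -> x u <> 0 \/ y u <> 0 ->
  continuity_pt (fun v => half_arg (x v) (y v)) u.
Proof.
  intros Cx Cy Hx Hxy. pose proof (modulus_pos _ _ Hxy) as Hm.
  pose proof (sqrt_lt_R0 _ Hm) as Hr. unfold half_arg.
  apply (continuity_pt_scal (fun v => atan (y v / (sqrt (x v ^ 2 + y v ^ 2) + x v))) 2).
  apply (continuity_pt_comp (fun v => y v / (sqrt (x v ^ 2 + y v ^ 2) + x v)) atan).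
  - apply (continuity_pt_div y (fun v => sqrt (x v ^ 2 + y v ^ 2) + x v)); [assumption| |lra].
    apply (continuity_pt_plus (fun v => sqrt (x v ^ 2 + y v ^ 2)) x); [|assumption].
    apply (continuity_pt_comp (fun v => x v ^ 2 + y v ^ 2) sqrt).
    + apply (continuity_pt_plus (fun v => x v ^ 2) (fun v => y v ^ 2));
        (apply (continuity_pt_comp _ (fun t => t ^ 2)); [assumption|]; reg).
    + apply continuity_pt_sqrt. lra.
  - apply derivable_continuous_pt, derivable_pt_atan.
Qed.

Lemma continuity_pt_Rsum {I : Type} (f : I -> R -> R) (l : list I) u :
  (forall i, In i l -> continuity_pt (f i) u) ->
  continuity_pt (fun v => Rsum (map (fun i => f i v) l)) u.
Proof.
  induction l as [|i l IH]; intros H; simpl.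
  - apply continuity_pt_const. intros ? ?; reflexivity.
  - apply (continuity_pt_plus (f i) (fun v => Rsum (map (fun i => f i v) l))).
    + apply H; now left.
    + apply IH. intros j Hj; apply H; now right.
Qed.

Lemma continuity_pt_atan_scale b u : continuity_pt (fun v => atan (v * b)) u.
Proof.
  apply (continuity_pt_comp (fun v => v * b) atan); [reg|].
  apply derivable_continuous_pt, derivable_pt_atan.
Qed.

(** * The last pivot *)

Lemma Csum_cons {I : Type} (F : I -> Cpx) i l : Csum F (i :: l) = Cadd (F i) (Csum F l).
Proof. reflexivity. Qed.

Lemma resolvent_zero bc s u :
  (forall q, In q bc -> 0 <= snd q) -> Rsum (map snd bc) <= 0 -> resolvent bc s u = Defs.C0.
Proof.
  unfold resolvent. induction bc as [|[b c] bc IH]; intros Hc Hs; [reflexivity|].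
  rewrite Csum_cons. simpl in Hs.
  assert (H0 : 0 <= c) by (apply (Hc (b, c)); now left).
  assert (Hbc : forall q, In q bc -> 0 <= snd q) by (intros q Hq; apply Hc; now right).
  assert (Hp : 0 <= Rsum (map snd bc)).
  { clear - Hbc. induction bc as [|q bc IH]; simpl; [lra|].
    pose proof (Hbc q (or_introl eq_refl)).
    pose proof (IH (fun q Hq => Hbc q (or_intror Hq))). lra. }
  rewrite IH by (assumption || lra). replace c with 0 by lra.
  unfold Cmul, Cadd, Defs.C0; simpl. f_equal; ring.
Qed.

Lemma Cre_Cinv_pos z : 0 < Cre z -> 0 < Cre (Cinv z).
Proof.
  intros Hz. unfold Cinv; cbn [Cre]. apply Rdiv_lt_0_compat; [assumption|].
  pose proof (pow2_ge_0 (Cim z)). nra.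
Qed.

(** Inversion preserves the open right half-plane, and the resolvent is a nonnegative combination of
    such inverses. *)
Lemma Cre_resolvent bc s u : 0 < Cre s -> (forall q, In q bc -> 0 <= snd q) ->
  0 <= Cre (resolvent bc s u) /\
  (0 < Rsum (map snd bc) -> 0 < Cre (resolvent bc s u)).
Proof.
  intros Hs. unfold resolvent. induction bc as [|[b c] bc IH]; intros Hc; [simpl; lra|].
  rewrite Csum_cons.
  assert (H0 : 0 <= c) by (apply (Hc (b, c)); now left).
  destruct IH as [IH1 IH2]; [intros q Hq; apply Hc; now right|].
  assert (Hz : 0 < Cre (Cinv (Cadd s (iR (u * b))))).
  { apply Cre_Cinv_pos. simpl. lra. }
  cbn [Cadd Cmul Cre Cim fst snd map Rsum fold_right]. fold (Rsum (map snd bc)). split.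
  - nra.
  - intros H. destruct (Req_dec c 0) as [->|Hc0]; [|nra].
    pose proof (IH2 ltac:(lra)). lra.
Qed.

Lemma resolvent_at_0 bc : resolvent bc Defs.C1 0 = mkC (Rsum (map snd bc)) 0.
Proof.
  unfold resolvent. induction bc as [|[b c] bc IH]; [reflexivity|].
  rewrite Csum_cons, IH. unfold Cinv, Cmul, Cadd; simpl. f_equal; field.
Qed.

Lemma continuity_pt_resolvent bc u :
  continuity_pt (fun v => Cre (resolvent bc Defs.C1 v)) u /\
  continuity_pt (fun v => Cim (resolvent bc Defs.C1 v)) u.
Proof.
  unfold resolvent. induction bc as [|[b c] bc [IH1 IH2]].
  - split; apply continuity_pt_const; intros ? ?; reflexivity.
  - set (F := fun (v : R) (q : R * R) =>
               Cmul (mkC (snd q) 0) (Cinv (Cadd Defs.C1 (iR (v * fst q))))).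
    assert (Hm : (1 + 0) ^ 2 + (0 + u * b) ^ 2 <> 0) by nra.
    split.
    + apply (continuity_pt_plus (fun v => Cre (F v (b, c))) (fun v => Cre (Csum (F v) bc)));
        [|assumption].
      unfold F; cbn [Cadd Cmul Cinv Cre Cim Defs.C1 iR fst snd]. reg; assumption.
    + apply (continuity_pt_plus (fun v => Cim (F v (b, c))) (fun v => Cim (Csum (F v) bc)));
        [|assumption].
      unfold F; cbn [Cadd Cmul Cinv Cre Cim Defs.C1 iR fst snd]. reg; assumption.
Qed.

(* The second factor of the determinant is a positive multiple of such a
   pivot; for [t = 0] the factor [u] or [u^2] is dropped to keep it nonzero at
   [u = 0]. *)
Definition pivot bc (x0 y0 k u : R) : Cpx :=
  Cadd (mkC x0 y0) (Cmul (mkC k 0) (resolvent bc Defs.C1 u)).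

(** If some c_k is positive, the resolvent has positive real part; otherwise it vanishes and the
    pivot is x0 + i y0. *)
Lemma pivot_half_plane bc x0 y0 k u :
  (forall q, In q bc -> 0 <= snd q) -> 0 <= x0 -> 0 <= k ->
  0 < x0 \/ y0 <> 0 \/ (0 < k /\ 0 < Rsum (map snd bc)) ->
  0 <= Cre (pivot bc x0 y0 k u) /\
  (Cre (pivot bc x0 y0 k u) <> 0 \/ Cim (pivot bc x0 y0 k u) <> 0).
Proof.
  intros Hc Hx Hk H.
  destruct (Cre_resolvent bc Defs.C1 u ltac:(simpl; lra) Hc) as [H1 H2].
  unfold pivot. cbn [Cadd Cmul Cre Cim]. split; [nra|].
  destruct (Rlt_le_dec 0 (Rsum (map snd bc))) as [Hs|Hs].
  - specialize (H2 Hs).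
    destruct (Rlt_le_dec 0 x0); [left; nra|]. destruct (Rlt_le_dec 0 k); [left; nra|].
    replace k with 0 by lra. right. destruct H as [H|[H|H]]; try lra.
  - rewrite (resolvent_zero bc _ _ Hc Hs). simpl. destruct H as [H|[H|H]]; [left|right|]; lra.
Qed.

(** The parameters x0, y0, k are separate from u because each path normalises its pivot differently:
    (1 - u, u a00, u^2), (1 / p^2, u a00, u^2), (0, a00, u) or (0, 0, 1). At u = 1 they all have the
    form (t, a00, 1). *)
Definition pencil_arg bc (x0 y0 k u : R) : R :=
  Rsum (map (fun q => atan (u * fst q)) bc)
  + half_arg (Cre (pivot bc x0 y0 k u)) (Cim (pivot bc x0 y0 k u)).

Lemma continuity_pt_pencil_arg bc (x0 y0 k : R -> R) u :
  (forall q, In q bc -> 0 <= snd q) ->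
  continuity_pt x0 u -> continuity_pt y0 u -> continuity_pt k u ->
  0 <= x0 u -> 0 <= k u ->
  0 < x0 u \/ y0 u <> 0 \/ (0 < k u /\ 0 < Rsum (map snd bc)) ->
  continuity_pt (fun v => pencil_arg bc (x0 v) (y0 v) (k v) v) u.
Proof.
  intros Hc Cx Cy Ck Hx Hk H.
  destruct (pivot_half_plane bc (x0 u) (y0 u) (k u) u Hc Hx Hk H).
  destruct (continuity_pt_resolvent bc u).
  set (Re := fun v => Cre (resolvent bc Defs.C1 v)) in *.
  set (Im := fun v => Cim (resolvent bc Defs.C1 v)) in *.
  unfold pencil_arg.
  apply (continuity_pt_plus (fun v => Rsum (map (fun q => atan (v * fst q)) bc))
    (fun v => half_arg (Cre (pivot bc (x0 v) (y0 v) (k v) v)) (Cim (pivot bc (x0 v) (y0 v) (k v) v)))).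
  - apply (continuity_pt_Rsum (fun q v => atan (v * fst q))).
    intros; apply continuity_pt_atan_scale.
  - apply continuity_pt_half_arg; try assumption.
    + apply (continuity_pt_plus x0 (fun v => k v * Re v - 0 * Im v)); [assumption|].
      apply (continuity_pt_minus (fun v => k v * Re v) (fun v => 0 * Im v)).
      * now apply (continuity_pt_mult k Re).
      * now apply (continuity_pt_scal Im 0).
    + apply (continuity_pt_plus y0 (fun v => k v * Im v + 0 * Re v)); [assumption|].
      apply (continuity_pt_plus (fun v => k v * Im v) (fun v => 0 * Re v)).
      * now apply (continuity_pt_mult k Im).
      * now apply (continuity_pt_scal Re 0).
Qed.

Lemma is_arg_pencil bc x0 y0 k u :
  (forall q, In q bc -> 0 <= snd q) -> 0 <= x0 -> 0 <= k ->
  0 < x0 \/ y0 <> 0 \/ (0 < k /\ 0 < Rsum (map snd bc)) ->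
  is_arg (Cmul (Cprod (fun q => Cadd Defs.C1 (iR (u * fst q))) bc) (pivot bc x0 y0 k u))
    (pencil_arg bc x0 y0 k u).
Proof.
  intros Hc Hx Hk H. destruct (pivot_half_plane bc x0 y0 k u Hc Hx Hk H) as [H1 H2].
  apply is_arg_mul.
  - apply is_arg_prod. intros; apply is_arg_1i.
  - destruct (pivot bc x0 y0 k u) as [a b]. now apply is_arg_half.
Qed.

Lemma Cmul_eq0 z w : Cmul z w = Defs.C0 -> z = Defs.C0 \/ w = Defs.C0.
Proof.
  destruct z as [a b], w as [c d]. unfold Cmul, Defs.C0; cbn [Cre Cim]. intros E.
  injection E as E1 E2.
  assert (H : (a ^ 2 + b ^ 2) * (c ^ 2 + d ^ 2) = 0).
  { replace ((a ^ 2 + b ^ 2) * (c ^ 2 + d ^ 2))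
      with ((a * c - b * d) ^ 2 + (a * d + b * c) ^ 2) by ring. rewrite E1, E2. ring. }
  apply Rmult_integral in H. destruct H as [H|H]; [left|right]; f_equal; nra.
Qed.

Lemma Cprod_eq0 {I : Type} (F : I -> Cpx) l :
  Cprod F l = Defs.C0 -> exists i, In i l /\ F i = Defs.C0.
Proof.
  induction l as [|i l IH]; intros E.
  - injection E as E. lra.
  - apply Cmul_eq0 in E. destruct E as [E|E].
    + exists i. split; [now left|assumption].
    + destruct (IH E) as (j & ? & ?). exists j. split; [now right|assumption].
Qed.

Lemma Cprod_factor0 {I : Type} (F : I -> Cpx) l i :
  In i l -> F i = Defs.C0 -> Cprod F l = Defs.C0.
Proof.
  intros Hi E. induction l as [|j l IH]; [destruct Hi|].
  destruct Hi as [->|Hi]; unfold Cprod; simpl; fold (Cprod F l).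
  - rewrite E. unfold Cmul, Defs.C0; simpl. f_equal; ring.
  - rewrite (IH Hi). unfold Cmul, Defs.C0; simpl. f_equal; ring.
Qed.

(** * The first row and the location of the spectrum *)

Definition row_norm2 (n : nat) (A : nat -> nat -> R) : R :=
  Rsum (map (fun j => A O j ^ 2) (seq 1 n)).

Lemma Rsum_squares_zero (f : nat -> R) l :
  Rsum (map (fun j => f j ^ 2) l) <= 0 -> forall j, In j l -> f j = 0.
Proof.
  intros H.
  assert (Hp : forall k, 0 <= Rsum (map (fun j => f j ^ 2) k)).
  { induction k as [|a k IH]; simpl; [lra|]. pose proof (pow2_ge_0 (f a)). simpl in *. lra. }
  induction l as [|a l IH]; intros j Hj; [destruct Hj|].
  cbn [map Rsum fold_right] in H. fold (Rsum (map (fun j => f j ^ 2) l)) in H.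
  pose proof (Hp l). pose proof (pow2_ge_0 (f a)).
  destruct Hj as [->|Hj]; [nra|]. apply IH; [lra|assumption].
Qed.

(** If the first row were zero, symmetry would kill the first column too, and A would be diag(0,
    A^+). *)
Lemma first_row_nonzero n A : Defs.symmetric (S n) A ->
  ~ (forall i j, (i < S n)%nat -> (j < S n)%nat -> A i j = diag0Aplus A i j) ->
  A O O <> 0 \/ 0 < row_norm2 n A.
Proof.
  intros Hsym Hnd. destruct (Req_dec (A O O) 0) as [H0|H0]; [|now left].
  destruct (Rlt_le_dec 0 (row_norm2 n A)) as [H1|H1]; [now right|]. exfalso. apply Hnd.
  pose proof (Rsum_squares_zero _ _ H1) as Hz.
  assert (Hr : forall j, (j < S n)%nat -> A O j = 0).
  { intros [|j] Hj; [assumption|]. apply Hz, in_seq. lia. }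
  intros i j Hi Hj. unfold diag0Aplus. destruct i as [|i]; [simpl; now apply Hr|].
  destruct j as [|j]; [|reflexivity]. simpl. rewrite Hsym by lia. now apply Hr.
Qed.

(** If Re l <= 0, then s = 1 - l has positive real part and the factorisation applies at z = - l, u
    = 1. Its first factors do not vanish, so l = i a00 + resolvent: the real part is nonnegative,
    and l = i a00 is nonzero when all c_k vanish. *)
Lemma specC_right_half_plane n A L : Defs.symmetric (S n) A ->
  A O O <> 0 \/ 0 < row_norm2 n A -> is_specC (S n) (InPlusiA A) L ->
  forall l, In l L -> 0 <= Cre l /\ (Cre l <> 0 \/ Cim l <> 0).
Proof.
  intros Hsym Hnz HL l Hl.
  destruct (Rlt_le_dec 0 (Cre l)) as [Hp|Hn]; [split; [|left]; lra|].
  destruct (Cdet_pencil Hsym) as (bc & Hc & Hsum & HD).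
  pose proof (specC_pencil HL (Copp l) (u := 1) ltac:(apply R1_neq_R0)) as E.
  rewrite (Cprod_factor0 _ L l Hl) in E; [|unfold Copp, Cadd, Cmul, Defs.C0; simpl; f_equal; ring].
  set (s := Cadd (Copp l) (mkC 1 0)) in E.
  assert (Hs : 0 < Cre s) by (simpl; lra).
  rewrite (HD _ _ _ Hs) in E. apply Cmul_eq0 in E. destruct E as [E|E].
  { apply Cprod_eq0 in E. destruct E as (q & _ & E). apply (f_equal Cre) in E.
    simpl in E, Hs. lra. }
  destruct (Cre_resolvent bc s 1 Hs Hc) as [H1 H2].
  pose proof (f_equal Cre E) as E1. pose proof (f_equal Cim E) as E2.
  cbn [Cadd Cmul Copp iR Cre Cim Defs.C0] in E1, E2.
  split; [lra|]. destruct (Rlt_le_dec 0 (Rsum (map snd bc))) as [Hpos|Hle].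
  - pose proof (H2 Hpos). lra.
  - rewrite (resolvent_zero bc s 1 Hc Hle) in E2. cbn [Cre Cim Defs.C0] in E2.
    destruct Hnz as [Hnz|Hnz]; [right; lra|].
    unfold row_norm2 in Hnz. change (Rsum (map snd bc) = row_norm2 n A) in Hsum.
    unfold row_norm2 in Hsum. lra.
Qed.

(** The body of the existential in [Cdet_pencil], named so that one list [bc] serves every
    comparison. *)
Definition pencil_factors (n : nat) (A : nat -> nat -> R) (bc : list (R * R)) : Prop :=
  (forall q, In q bc -> 0 <= snd q) /\
  Rsum (map snd bc) = row_norm2 n A /\
  forall t s u, 0 < Cre s ->
    Cdet (S n) (pencil t s u A) =
    Cmul (Cprod (fun q => Cadd s (iR (u * fst q))) bc)
      (Cadd (Cadd t (iR (u * A O O))) (Cmul (mkC (u ^ 2) 0) (resolvent bc s u))).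

(** * Comparison of arguments along the paths *)

Lemma half_arg_real x : half_arg x 0 = 0.
Proof.
  unfold half_arg. replace (0 / (sqrt (x ^ 2 + 0 ^ 2) + x)) with 0 by (unfold Rdiv; ring).
  rewrite atan_0. ring.
Qed.

Lemma Rsum_zero {I : Type} (f : I -> R) l : (forall i, f i = 0) -> Rsum (map f l) = 0.
Proof. intros H. induction l as [|i l IH]; simpl; [reflexivity|]. rewrite H, IH. ring. Qed.

Lemma Rsum_ext {I : Type} (f g : I -> R) l :
  (forall i, In i l -> f i = g i) -> Rsum (map f l) = Rsum (map g l).
Proof. intros H. f_equal. now apply map_ext_in. Qed.

Lemma atan_scale0 {I : Type} (f : I -> R) l : Rsum (map (fun i => atan (0 * f i)) l) = 0.
Proof. apply Rsum_zero. intros i. rewrite Rmult_0_l. apply atan_0. Qed.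

Lemma is_arg_Cdet_pencil n A bc x0 u : pencil_factors n A bc -> 0 <= x0 ->
  0 < x0 \/ u * A O O <> 0 \/ (0 < u ^ 2 /\ 0 < row_norm2 n A) ->
  is_arg (Cdet (S n) (pencil (mkC x0 0) Defs.C1 u A))
    (pencil_arg bc x0 (u * A O O) (u ^ 2) u).
Proof.
  intros (Hc & Hs & HD) Hx H. rewrite HD by (simpl; lra).
  replace (Cadd (mkC x0 0) (iR (u * A O O))) with (mkC x0 (u * A O O))
    by (unfold Cadd; simpl; f_equal; ring).
  apply is_arg_pencil; try assumption; [apply pow2_ge_0|]. now rewrite Hs.
Qed.

(** The path joins the identity to I_n + i A linearly, so both lifts start at 0. Its corner 1 - u is
    positive until u = 1, where the nonzero first row takes over. *)
Lemma specC_arg_sum n A bc L : Defs.symmetric (S n) A ->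
  A O O <> 0 \/ 0 < row_norm2 n A -> pencil_factors n A bc ->
  is_specC (S n) (InPlusiA A) L ->
  Rsum (map Carg L) = pencil_arg bc 0 (A O O) 1 1.
Proof.
  intros Hsym Hnz Hbc HL. pose proof (specC_right_half_plane n A L Hsym Hnz HL) as Hre.
  rewrite (Rsum_ext Carg (fun l => half_arg (1 - 1 + 1 * Cre l) (1 * Cim l))).
  2: { intros l Hl. destruct (Hre l Hl). rewrite Carg_half by assumption. f_equal; ring. }
  replace (pencil_arg bc 0 (A O O) 1 1)
    with (pencil_arg bc (1 - 1) (1 * A O O) (1 ^ 2) 1) by (f_equal; ring).
  assert (Hcond : forall u, 0 <= u <= 1 ->
    0 < 1 - u \/ u * A O O <> 0 \/ (0 < u ^ 2 /\ 0 < row_norm2 n A)).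
  { intros u Hu. destruct (Rlt_le_dec u 1); [left; lra|]. replace u with 1 by lra.
    right. destruct Hnz; [left|right]; lra. }
  assert (HreU : forall u l, 0 <= u <= 1 -> In l L -> 0 <= 1 - u + u * Cre l /\
    (1 - u + u * Cre l <> 0 \/ u * Cim l <> 0)).
  { intros u l Hu Hl. destruct (Hre l Hl) as [Hp Hn]. split; [nra|].
    destruct (Rlt_le_dec u 1); [left; nra|]. replace u with 1 by lra.
    destruct Hn; [left|right]; lra. }
  symmetry.
  apply (arg_lift_unique (fun u => pencil_arg bc (1 - u) (u * A O O) (u ^ 2) u)
    (fun u => Rsum (map (fun l => half_arg (1 - u + u * Cre l) (u * Cim l)) L))).
  - intros u Hu. destruct Hbc as (Hc & Hs & _).
    apply (continuity_pt_pencil_arg bc (fun u => 1 - u) (fun u => u * A O O) (fun u => u ^ 2));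
      [assumption|reg|reg|reg|lra|apply pow2_ge_0|]. rewrite Hs. now apply Hcond.
  - intros u Hu.
    apply (continuity_pt_Rsum (fun l u => half_arg (1 - u + u * Cre l) (u * Cim l))).
    intros l Hl. destruct (HreU u l Hu Hl).
    apply (continuity_pt_half_arg (fun u => 1 - u + u * Cre l) (fun u => u * Cim l));
      [reg|reg|assumption|assumption].
  - rewrite Rsum_zero; [|intros l; rewrite !Rmult_0_l; apply half_arg_real].
    unfold pencil_arg, pivot. rewrite atan_scale0, resolvent_at_0.
    cbn [Cadd Cmul Cre Cim].
    match goal with |- _ + half_arg ?x ?y = _ => replace y with 0 by ring end.
    rewrite half_arg_real. ring.
  - intros u Hu. exists (Cdet (S n) (pencil (mkC (1 - u) 0) Defs.C1 u A)). split.
    + apply is_arg_Cdet_pencil; [assumption|lra|apply Hcond; lra].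
    + pose proof (specC_pencil HL (mkC (1 - u) 0) (u := u) (Rgt_not_eq _ _ (proj1 Hu))) as E.
      replace (Cadd (mkC (1 - u) 0) (mkC u 0)) with Defs.C1 in E
        by (unfold Cadd, Defs.C1; simpl; f_equal; ring).
      rewrite E. apply is_arg_prod. intros l Hl.
      replace (Cadd (mkC (1 - u) 0) (Cmul (mkC u 0) l))
        with (mkC (1 - u + u * Cre l) (u * Cim l))
        by (unfold Cadd, Cmul; simpl; f_equal; ring).
      apply is_arg_half; apply HreU; [lra|assumption|lra|assumption].
Qed.

(** The path is I + i u A_p; the positive factor p^2 relating it to the pencil leaves arguments
    unchanged. *)
Lemma specR_arg_sum n A bc p L : 0 < p -> pencil_factors n A bc ->
  is_specR (S n) (Ap p A) L ->
  Rsum (map atan L) = pencil_arg bc (/ p ^ 2) (A O O) 1 1.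
Proof.
  intros Hp Hbc HL. assert (Hp2 : 0 < p ^ 2) by nra.
  pose proof (Rinv_0_lt_compat _ Hp2) as Hip.
  rewrite (Rsum_ext atan (fun l => atan (1 * l))) by (intros; f_equal; ring).
  replace (pencil_arg bc (/ p ^ 2) (A O O) 1 1)
    with (pencil_arg bc (/ p ^ 2) (1 * A O O) (1 ^ 2) 1) by (f_equal; ring).
  symmetry.
  apply (arg_lift_unique (fun u => pencil_arg bc (/ p ^ 2) (u * A O O) (u ^ 2) u)
    (fun u => Rsum (map (fun l => atan (u * l)) L))).
  - intros u Hu. destruct Hbc as (Hc & Hs & _).
    apply (continuity_pt_pencil_arg bc (fun u => / p ^ 2) (fun u => u * A O O) (fun u => u ^ 2));
      [assumption| |reg|reg|lra|apply pow2_ge_0|left; lra].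
    apply continuity_pt_const; intros ? ?; reflexivity.
  - intros u Hu. apply (continuity_pt_Rsum (fun l u => atan (u * l))).
    intros; apply continuity_pt_atan_scale.
  - rewrite (atan_scale0 (fun l => l)).
    unfold pencil_arg, pivot. rewrite atan_scale0, resolvent_at_0.
    cbn [Cadd Cmul Cre Cim].
    match goal with |- _ + half_arg ?x ?y = _ => replace y with 0 by ring end.
    rewrite half_arg_real. ring.
  - intros u Hu.
    exists (Cmul (mkC (p ^ 2) 0) (Cdet (S n) (pencil (mkC (/ p ^ 2) 0) Defs.C1 u A))). split.
    + apply is_arg_scale; [assumption|].
      apply is_arg_Cdet_pencil; [assumption|lra|left; lra].
    + rewrite <- (specR_pencil (Rgt_not_eq _ _ Hp) HL (Rgt_not_eq _ _ (proj1 Hu))).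
      apply is_arg_prod. intros; apply is_arg_1i.
Qed.

(** At u = 0 the pivot divided by u is i a00, whose argument is the sign term. *)
Lemma chi_arg_sum_nonzero n A bc mu : A O O <> 0 -> pencil_factors n A bc ->
  length mu = n ->
  (forall x, chi_inf n A x = (-1) ^ n * rho n A 1 * Rprod_lin mu x) ->
  pencil_arg bc 0 (A O O) 1 1 = PI / 2 * Rsign (A O O) + Rsum (map atan mu).
Proof.
  intros H0 Hbc Hlen Hchi. pose proof PI_RGT_0.
  rewrite rho1E in Hchi.
  rewrite (Rsum_ext atan (fun l => atan (1 * l))) by (intros; f_equal; ring).
  apply (arg_lift_unique (fun u => pencil_arg bc 0 (A O O) u u)
    (fun u => PI / 2 * Rsign (A O O) + Rsum (map (fun l => atan (u * l)) mu))).
  - intros u Hu. destruct Hbc as (Hc & Hs & _).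
    apply (continuity_pt_pencil_arg bc (fun u => 0) (fun u => A O O) (fun u => u));
      [assumption|reg|reg|reg|lra|lra|right; left; assumption].
  - intros u Hu.
    apply (continuity_pt_plus (fun _ => PI / 2 * Rsign (A O O))
            (fun u => Rsum (map (fun l => atan (u * l)) mu))).
    + apply continuity_pt_const; intros ? ?; reflexivity.
    + apply (continuity_pt_Rsum (fun l u => atan (u * l))).
      intros; apply continuity_pt_atan_scale.
  - rewrite (atan_scale0 (fun l => l)), Rplus_0_r.
    unfold pencil_arg, pivot. rewrite atan_scale0, resolvent_at_0, Rplus_0_l.
    cbn [Cadd Cmul Cre Cim].
    match goal with |- half_arg ?x ?y = _ =>
      replace x with 0 by ring; replace y with (A O O) by ring end.
    apply half_arg_unique; [lra|now right|now apply is_arg_imag|].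
    unfold Rsign. destruct (Rlt_dec 0 (A O O)); [lra|]. destruct (Rlt_dec (A O O) 0); lra.
  - intros u Hu. exists (Cdet (S n) (pencil Defs.C0 Defs.C1 u A)). split.
    + destruct Hbc as (Hc & Hs & HD). rewrite HD by (simpl; lra).
      set (B := Cprod _ bc).
      (* One factor u > 0 is taken out: i u a00 + u^2 R = u (i a00 + u R). *)
      replace (Cmul B _) with (Cmul (mkC u 0) (Cmul B (pivot bc 0 (A O O) u u)))
        by (unfold pivot, Cadd, Cmul; simpl; f_equal; ring).
      apply is_arg_scale; [lra|].
      apply is_arg_pencil; [assumption|lra|lra|right; left; assumption].
    + rewrite (chi_pencil1 Hlen Hchi (Rgt_not_eq _ _ (proj1 Hu))).
      apply is_arg_mul; [|apply is_arg_prod; intros; apply is_arg_1i].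
      replace (iR (u * A O O)) with (Cmul (mkC u 0) (iR (A O O)))
        by (unfold Cmul, iR; simpl; f_equal; ring).
      apply is_arg_scale; [lra|]. now apply is_arg_imag.
Qed.

(** The pivot divided by u^2 is the resolvent itself, which at u = 0 is the positive number |a|^2;
    both lifts therefore start at 0. *)
Lemma chi_arg_sum_zero n A bc l : Defs.symmetric (S n) A ->
  A O O = 0 -> 0 < row_norm2 n A -> pencil_factors n A bc ->
  length l = (n - 1)%nat ->
  (forall x, chi_inf n A x = (-1) ^ (n - 1) * rho n A 2 * Rprod_lin l x) ->
  pencil_arg bc 0 (A O O) 1 1 = Rsum (map atan l).
Proof.
  intros Hsym H0 Hpos Hbc Hlen Hchi.
  (* For n = 0 the row norm is an empty sum, so it cannot be positive. *)
  destruct n as [|n]; [unfold row_norm2 in Hpos; simpl in Hpos; lra|].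
  rewrite (rho2E Hsym eq_refl H0) in Hchi. fold (row_norm2 (S n) A) in Hchi.
  replace (S n - 1)%nat with n in Hlen, Hchi by lia. rewrite H0.
  rewrite (Rsum_ext atan (fun l => atan (1 * l))) by (intros; f_equal; ring).
  apply (arg_lift_unique (fun u => pencil_arg bc 0 0 1 u)
    (fun u => Rsum (map (fun l => atan (u * l)) l))).
  - intros u Hu. destruct Hbc as (Hc & Hs & _).
    apply (continuity_pt_pencil_arg bc (fun u => 0) (fun u => 0) (fun u => 1));
      [assumption|reg|reg|reg|lra|lra|right; right; lra].
  - intros u Hu. apply (continuity_pt_Rsum (fun l u => atan (u * l))).
    intros; apply continuity_pt_atan_scale.
  - rewrite (atan_scale0 (fun l => l)).
    unfold pencil_arg, pivot. rewrite atan_scale0, resolvent_at_0, Rplus_0_l.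
    cbn [Cadd Cmul Cre Cim].
    match goal with |- half_arg ?x ?y = _ => replace y with 0 by ring end.
    apply half_arg_real.
  - intros u Hu. exists (Cdet (S (S n)) (pencil Defs.C0 Defs.C1 u A)).
    assert (Hu2 : 0 < u ^ 2) by nra. split.
    + destruct Hbc as (Hc & Hs & HD). rewrite HD by (simpl; lra). rewrite H0.
      set (B := Cprod _ bc).
      replace (Cmul B _) with (Cmul (mkC (u ^ 2) 0) (Cmul B (pivot bc 0 0 1 u)))
        by (unfold pivot, Cadd, Cmul; simpl; f_equal; ring).
      apply is_arg_scale; [lra|].
      apply is_arg_pencil; [assumption|lra|lra|right; right; lra].
    + rewrite (chi_pencil2 Hlen Hchi (Rgt_not_eq _ _ (proj1 Hu))).
      apply is_arg_scale; [nra|]. apply is_arg_prod; intros; apply is_arg_1i.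
Qed.

(* For A symmetric of size n+1 with A <> diag(0,A^+), and mu the list
   [mu_1(A); ...; mu_n(A)]:
   (1) Theta_hat(A) = sum of arg over the spectrum of I_n + iA equals
       PI/2 sign(a00) + sum_j atan mu_j;
   (2) tr atan(A_p) (= sum of atan over the spectrum of A_p) tends to the
       same value as p -> +infinity. *)
Theorem theoremA4 (n : nat) (A : nat -> nat -> R)
  (Hsym : symmetric (S n) A)
  (Hnd : ~ (forall i j, (i < S n)%nat -> (j < S n)%nat -> A i j = diag0Aplus A i j))
  (mu : list R) (Hmu : is_mu_list n A mu) :
  (forall L : list Cpx, is_specC (S n) (InPlusiA A) L ->
     Rsum (map Carg L) = PI / 2 * Rsign (A O O) + Rsum (map atan mu)) /\
  (forall eps : R, 0 < eps -> exists P : R, forall p : R, P < p ->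
     forall L : list R, is_specR (S n) (Ap p A) L ->
       Rabs (Rsum (map atan L) - (PI / 2 * Rsign (A O O) + Rsum (map atan mu))) < eps).
Proof.
  pose proof (first_row_nonzero n A Hsym Hnd) as Hnz.
  destruct (Cdet_pencil Hsym) as (bc & Hbc). change (pencil_factors n A bc) in Hbc.
  assert (Hmain : pencil_arg bc 0 (A O O) 1 1 = PI / 2 * Rsign (A O O) + Rsum (map atan mu)).
  { destruct Hmu as [(H0 & Hlen & _ & Hchi)|(H0 & l & -> & Hlen & _ & Hchi)].
    - now apply (chi_arg_sum_nonzero n).
    - destruct Hnz as [Hnz|Hnz]; [contradiction|].
      rewrite (chi_arg_sum_zero n A bc l); try assumption.
      (* The sign term is 0, and the appended entry mu_n = 0 contributes atan 0. *)
      rewrite H0. unfold Rsign. destruct (Rlt_dec 0 0); [lra|].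
      rewrite Rmult_0_r, Rplus_0_l, map_app. clear.
      induction l as [|x l IH]; simpl; [rewrite atan_0; ring|]. now rewrite IH. }
  rewrite <- Hmain. split.
  - intros L HL. now apply (specC_arg_sum n A).
  - intros eps Heps.
    (* By [specR_arg_sum] the trace is this function at e = 1 / p^2, so the limit amounts to
       continuity at e = 0. *)
    assert (Hcont : continuity_pt (fun e => pencil_arg bc e (A O O) 1 1) 0).
    { pose proof Hbc as (Hc & Hs & _).
      destruct (pivot_half_plane bc 0 (A O O) 1 1 Hc ltac:(lra) ltac:(lra)) as [H1 H2].
      { right. rewrite Hs. destruct Hnz; [now left|right; lra]. }
      apply (continuity_pt_plus (fun _ => Rsum (map (fun q => atan (1 * fst q)) bc))
        (fun e => half_arg (Cre (pivot bc e (A O O) 1 1)) (Cim (pivot bc e (A O O) 1 1)))).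
      - apply continuity_pt_const; intros ? ?; reflexivity.
      - apply (continuity_pt_half_arg (fun e => Cre (pivot bc e (A O O) 1 1))
                 (fun e => Cim (pivot bc e (A O O) 1 1))); try assumption;
          unfold pivot; cbn [Cadd Cre Cim]; reg. }
    destruct (Hcont eps Heps) as (d & Hd & Hlim).
    (* Both p > 1 and p > 1 / d hold beyond this bound, whence p^2 > 1 / d. *)
    exists (1 + / d). intros p Hp L HL. pose proof (Rinv_0_lt_compat _ Hd) as Hid.
    rewrite (specR_arg_sum n A bc p L ltac:(lra) Hbc HL).
    assert (Hp2 : / d < p ^ 2) by nra.
    assert (Hip : 0 < / p ^ 2 < d).
    { split; [apply Rinv_0_lt_compat; lra|].
      rewrite <- (Rinv_inv d). apply Rinv_lt_contravar; [nra|assumption]. }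
    apply (Hlim (/ p ^ 2)). split.
    + split; [exact I|lra].
    + simpl. unfold Rdist. rewrite Rminus_0_r, Rabs_pos_eq; simpl in *; lra.
Qed.
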